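(* Let $l\ge3$ and let $(p_1,p_2,\dots,p_l)$ be an $l$-tuple of pairwise relatively prime integers with $1<p_1<\dots<p_l$. Then $$\kappa(p_1,p_2,\dots,p_l)=\sum_{j=1}^{l-2}\frac{(l-j-1)(l-j)}{2}A_j .$$
   Context: Let $(e_0,p_1',\dots,p_l')$ be the unique integers with $1\le p_i'\le p_i-1$ and $e_0p_1\cdots p_l+\sum_{i=1}^l p_i'\prod_{j\ne i}p_j=-1$. Define $$\Delta(n)=1+|e_0|n-\sum_{i=1}^l\left\lceil\frac{np_i'}{p_i}\right\rceil\quad(n\in\mathbb{Z}_{\ge0}),\qquad \kappa(p_1,\dots,p_l)=\left|\sum_{n=0}^\infty\min\{0,\Delta(n)\}\right| .$$ For an integer $k$ put $N_0(k)=p_1\cdots p_l\left(k-\sum_{i=1}^l\frac1{p_i}\right)$. If $N_0(k)>0$, let $T_k$ be the tetrahedron cut out of the first orthant of $\mathbb{R}^l$ by the hyperplane $\sum_i x_i/p_i=N_0(k)/(p_1\cdots p_l)$, i.e. $$T_k=\left\{x\in\mathbb{R}_{\ge0}^l:\sum_{i=1}^l\frac{x_i}{p_i}\le\frac{N_0(k)}{p_1\cdots p_l}\right\},$$ and let $T_k=\emptyset$ if $N_0(k)<0$. Let $C=[0,p_1-1]\times\cdots\times[0,p_l-1]\subset\mathbb{R}^l$ and $$A_k=\#\left((T_k\setminus T_{k-1})\cap C\cap\mathbb{Z}^l\right).$$ *)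

(* Defs.v *)
From HB Require Import structures.
From mathcomp Require Import all_boot all_order all_algebra finmap.
From mathcomp Require Import all_classical all_reals all_analysis.
From mathcomp Require Import zify ring.

Set Implicit Arguments.
Unset Strict Implicit.
Unset Printing Implicit Defensive.

Import Order.TTheory GRing.Theory Num.Theory.

Local Open Scope classical_set_scope.
Local Open Scope ring_scope.

Definition seifert_spec (l : nat) (p : 'I_l -> nat)
    (s : int * {ffun 'I_l -> int}) : Prop :=
  (forall i, 1 <= s.2 i <= (p i)%:Z - 1) /\
  s.1 * \prod_i (p i)%:Z + \sum_i s.2 i * \prod_(j | j != i) (p j)%:Z = -1.

(* The integers (e_0, p'_1, ..., p'_l). The default value of [xget] is never
   used for pairwise coprime p_i > 1: see [seifert_spec_exists] and
   [seifert_spec_unique]. *)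
Definition seifert (l : nat) (p : 'I_l -> nat) : int * {ffun 'I_l -> int} :=
  xget (0, [ffun=> 0]) [set s | seifert_spec p s].

Definition e0 (l : nat) (p : 'I_l -> nat) : int := (seifert p).1.

Definition p' (l : nat) (p : 'I_l -> nat) (i : 'I_l) : int := (seifert p).2 i.

Definition Delta (l : nat) (p : 'I_l -> nat) (n : nat) : int :=
  1 + `|e0 p| * n%:Z
  - \sum_i Num.ceil (n%:R * (p' p i)%:~R / (p i)%:R : rat).

(* The terms are nonpositive, so the series always has a value in \bar R. *)
Definition kappa (R : realType) (l : nat) (p : 'I_l -> nat) : \bar R :=
  (`| \sum_(0 <= n <oo) (Num.min 0 (Delta p n))%R%:~R%:E |)%E.
Arguments kappa R {l} p.

Definition N0 (R : realType) (l : nat) (p : 'I_l -> nat) (k : int) : R :=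
  (\prod_i (p i)%:R) * (k%:~R - \sum_i (p i)%:R^-1).
Arguments N0 R {l} p k.

Definition tetrahedron (R : realType) (l : nat) (p : 'I_l -> nat) (k : int) :
    set 'rV[R]_l :=
  if 0 < N0 R p k then
    [set x : 'rV[R]_l | (forall i, 0 <= x ord0 i) /\
                          \sum_i x ord0 i / (p i)%:R <= N0 R p k / \prod_i (p i)%:R]
  else set0.
Arguments tetrahedron R {l} p k.

Definition box (R : realType) (l : nat) (p : 'I_l -> nat) : set 'rV[R]_l :=
  [set x : 'rV[R]_l | forall i, 0 <= x ord0 i <= (p i)%:R - 1].
Arguments box R {l} p.

Definition lattice (R : realType) (l : nat) : set 'rV[R]_l :=
  [set x : 'rV[R]_l | forall i, x ord0 i \is a Num.int].
Arguments lattice R l : clear implicits.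

(* The set being counted is finite, as it consists of lattice points of a box;
   [fset_set] is therefore not degenerate here. *)
Definition A (R : realType) (l : nat) (p : 'I_l -> nat) (k : int) : nat :=
  #|` fset_set ((tetrahedron R p k `\` tetrahedron R p (k - 1))
                `&` box R p `&` lattice R l)|.
Arguments A R {l} p k.

Section SeifertSpec.
Variables (l : nat) (p : 'I_l -> nat).
Hypothesis p_gt1 : forall i, (1 < p i)%N.
Hypothesis p_coprime : forall i j, i != j -> coprime (p i) (p j).

Let Q (i : 'I_l) : int := \prod_(j | j != i) (p j)%:Z.

Let coprime_Q i : coprimez (p i)%:Z (Q i).
Proof.
rewrite /Q; elim/big_rec: _ => [|j x ji IH].
  by rewrite coprimezE coprimen1.
by rewrite coprimezMr IH andbT; apply: p_coprime; rewrite eq_sym.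
Qed.

Let dvd_sumQ (s : 'I_l -> int) i :
  ((p i)%:Z %| (\sum_j s j * Q j) - s i * Q i)%Z.
Proof.
rewrite (bigD1 i)//= addrAC subrr add0r.
apply: rpred_sum => j ji; rewrite dvdz_mull// /Q (bigD1 i) 1?eq_sym//=.
exact: dvdz_mulr.
Qed.

Lemma seifert_spec_exists : exists s, seifert_spec p s.
Proof.
have inv i : exists a : int,
    1 <= a <= (p i)%:Z - 1 /\ ((p i)%:Z %| a * Q i + 1)%Z.
  have p1 := p_gt1 i; have pi0 : (p i)%:Z != 0 by lia.
  have [u [v]] := Bezoutz (p i)%:Z (Q i); rewrite (eqP (coprime_Q i)) => uv.
  have dvdv : ((p i)%:Z %| ((- v) %% (p i)%:Z)%Z * Q i + 1)%Z.
    apply/dvdzP; exists (u - ((- v) %/ (p i)%:Z)%Z * Q i).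
    by rewrite /modz -uv; ring.
  exists ((- v) %% (p i)%:Z)%Z; split=> //.
  have : ((- v) %% (p i)%:Z)%Z != 0.
    by apply: contraTneq dvdv => ->; rewrite mul0r add0r dvdz1/=; lia.
  have := modz_ge0 (- v) pi0; have := @ltz_pmod (- v) (p i)%:Z.
  by move: (modz _ _) => m; lia.
have [a aP] := choice inv.
have : (\prod_i (p i)%:Z %| \sum_i a i * Q i + 1)%Z.
  have pdvd i : ((p i)%:Z %| \sum_i a i * Q i + 1)%Z.
    by have := rpredD (dvd_sumQ a i) (aP i).2; rewrite addrA subrK.
  move: (\sum_i _ + 1) pdvd => S pdvd.
  elim: (index_enum _) (index_enum_uniq 'I_l) => [|i r IH].
    by rewrite big_nil dvd1z.
  rewrite cons_uniq big_cons => /andP[ir /IH rd].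
  rewrite Gauss_dvdz ?pdvd ?rd// big_seq; elim/big_rec: _ => [|j x jr xc].
    by rewrite coprimezE coprimen1.
  by rewrite coprimezMr xc andbT; apply: p_coprime; apply: contraNneq ir => ->.
move=> /dvdzP[q qE]; exists (- q, [ffun i => a i]); split=> [i|] /=.
  by rewrite ffunE; exact: (aP i).1.
under [X in _ + X]eq_bigr do rewrite ffunE -/(Q _).
by rewrite mulNr -qE; ring.
Qed.

Lemma seifert_spec_unique s t : seifert_spec p s -> seifert_spec p t -> s = t.
Proof.
case: s t => [e s] [f t] [/= s1 sE] [/= t1 tE].
have st : s = t.
  apply/ffunP => i.
  have dvd_spec (u : {ffun 'I_l -> int}) (g : int) :
      g * \prod_j (p j)%:Z + \sum_j u j * Q j = -1 ->
      ((p i)%:Z %| u i * Q i + 1)%Z.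
    move=> uE; have /dvdzP[q] := dvd_sumQ u i.
    move: uE; rewrite (bigD1 i)//= -/(Q i) => uE qE.
    apply/dvdzP; exists (- g * Q i - q).
    rewrite mulrBl -qE; move: (\sum_j _) uE => S.
    by move=> /(canRL (addKr _)) ->; ring.
  have : ((p i)%:Z %| (s i - t i) * Q i)%Z.
    rewrite (_ : _ * _ = s i * Q i + 1 - (t i * Q i + 1)); last by ring.
    exact: rpredB (dvd_spec _ _ sE) (dvd_spec _ _ tE).
  rewrite Gauss_dvdzl ?coprime_Q// -eqz_mod_dvd => /eqP.
  by rewrite !modz_small//; [have := t1 i|have := s1 i]; lia.
subst t; congr pair; move: sE; rewrite -tE => /addIr /mulIf; apply.
by apply/prodf_neq0 => i _; have := p_gt1 i; lia.
Qed.

End SeifertSpec.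

(* Main.v *)
(** Write P = p_1 ... p_l, and let r_i(n) be the residue of -n p'_i modulo p_i.
    Clearing the ceilings in Delta gives
      n + P (1 - Delta(n)) = sum_i r_i(n) P / p_i,
    and by the Chinese remainder theorem n mod P |-> (r_i(n))_i is a bijection
    onto the lattice points of the box C.  Moreover Delta(n + P) = Delta(n) + 1,
    so each residue class m < P contributes 1 + 2 + ... + (K - 1) = K (K - 1) / 2
    to kappa, where K = 1 - Delta(m) is the integer part of sum_i r_i(m) / p_i.
    The reflection x_i = p_i - 1 - r_i turns K >= l - k into x \in T_k, so A_j
    counts the m < P with K = l - j. *)

Require Import Defs.
From mathcomp Require Import all_boot all_order all_algebra finmap.
From mathcomp Require Import all_classical all_reals all_analysis.
From mathcomp Require Import zify ring.

Import Order.TTheory GRing.Theory Num.Theory.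

Local Open Scope ring_scope.

Set Implicit Arguments.
Unset Strict Implicit.

(** Dividing [- a] instead of [a] turns the ceiling into a quotient: if - a = q b + r with 0 <= r <
    b, then the ceiling of a / b is - q. *)
Lemma ceil_divz (a b : int) : 0 < b ->
  Num.ceil (a%:~R / b%:~R : rat) * b = a + ((- a) %% b)%Z.
Proof.
move=> b0; have m0 := modz_ge0 (- a) (lt0r_neq0 b0); have mb := ltz_pmod (- a) b0.
have aE := divz_eq (- a) b; move: (_ %/ _)%Z (_ %% _)%Z m0 mb aE => q r r0 rb aE.
have -> : a = - (q * b + r) by rewrite -aE opprK.
rewrite (@ceil_def _ _ (- q)); first by ring.
have b0' : 0 < b%:~R :> rat by rewrite ltr0z.
rewrite ltr_pdivlMr// ler_pdivrMr// -!intrM ltr_int ler_int; nia.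
Qed.

(** * Residues modulo the p_i and the integer form of [Delta] *)

Section Residues.
Variables (l : nat) (p : 'I_l -> nat).
Hypothesis p_gt1 : forall i, (1 < p i)%N.
Hypothesis p_coprime : forall i j, i != j -> coprime (p i) (p j).

Definition total : nat := (\prod_i p i)%N.

Definition cofac (i : 'I_l) : int := \prod_(j | j != i) (p j)%:Z.

Definition res (i : 'I_l) (n : nat) : int := ((- (n%:Z * p' p i)) %% (p i)%:Z)%Z.

Lemma p_gt0z i : 0 < (p i)%:Z.
Proof. by have := p_gt1 i; lia. Qed.

Lemma total_gt0 : (0 < total)%N.
Proof. by apply: prodn_gt0 => i; rewrite ltnW. Qed.

Lemma totalE : total%:Z = \prod_i (p i)%:Z.
Proof. by rewrite -natz natr_prod; apply: eq_bigr => i _; rewrite natz. Qed.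

Lemma total_cofac i : total%:Z = (p i)%:Z * cofac i.
Proof. by rewrite totalE (bigD1 i). Qed.

Lemma cofac_gt0 i : 0 < cofac i.
Proof. by apply: prodr_gt0 => j _; exact: p_gt0z. Qed.

Lemma coprime_cofac i : coprimez (p i)%:Z (cofac i).
Proof.
rewrite /cofac; elim/big_rec: _ => [|j x ji IH].
  by rewrite coprimezE coprimen1.
by rewrite coprimezMr IH andbT; apply: p_coprime; rewrite eq_sym.
Qed.

Lemma dvd_sum_cofac (s : 'I_l -> int) i :
  ((p i)%:Z %| (\sum_j s j * cofac j) - s i * cofac i)%Z.
Proof.
rewrite (bigD1 i)//= addrAC subrr add0r.
apply: rpred_sum => j ji; rewrite dvdz_mull// /cofac (bigD1 i) 1?eq_sym//=.
exact: dvdz_mulr.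
Qed.

(** Modulo [p i] the other cofactors vanish and [cofac i] is invertible, so equality would make
    [p i] divide 1. This is what keeps N_0(k) away from 0. *)
Lemma sum_cofac_neq (k : int) : (0 < l)%N -> \sum_i cofac i != k * total%:Z.
Proof.
move=> l0; pose i := Ordinal l0; apply/eqP => sE.
have := dvd_sum_cofac (fun=> 1) i.
under eq_bigr do rewrite mul1r.
rewrite mul1r sE (total_cofac i) rpredBl; last by rewrite dvdz_mull// dvdz_mulr.
rewrite -[cofac i]mul1r Gauss_dvdzl ?coprime_cofac// dvdz1 /=.
by have := p_gt1 i; lia.
Qed.

Lemma seifertP : seifert_spec p (seifert p).
Proof. by rewrite /seifert; apply: xgetPex; exact: seifert_spec_exists. Qed.

Lemma seifert_eq : e0 p * total%:Z + \sum_i p' p i * cofac i = -1.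
Proof. by rewrite totalE; have [] := seifertP. Qed.

Lemma e0_lt0 : e0 p < 0.
Proof.
have : 0 <= \sum_i p' p i * cofac i.
  apply: sumr_ge0 => i _; rewrite mulr_ge0 ?(ltW (cofac_gt0 i))//.
  by have [/(_ i)/andP[+ _] _] := seifertP; exact: le_trans.
by have := seifert_eq; have := total_gt0; nia.
Qed.

Lemma res_bound i n : 0 <= res i n < (p i)%:Z.
Proof. by rewrite modz_ge0 ?(lt0r_neq0 (p_gt0z i))//= ltz_pmod ?p_gt0z. Qed.

(** Reducing [seifert_eq] modulo [p i] gives p'_i [cofac i] = -1, and [res i n] is - n p'_i modulo
    [p i]. *)
Lemma dvd_res i n : ((p i)%:Z %| res i n * cofac i - n%:Z)%Z.
Proof.
have [|q qE] := dvdzP (_ : ((p i)%:Z %| p' p i * cofac i + 1)%Z).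
  have -> : p' p i * cofac i + 1 = - (e0 p * total%:Z) -
      ((\sum_j p' p j * cofac j) - p' p i * cofac i).
    by have := seifert_eq; move: (\sum_j _) => S /(canRL (addKr _)) ->; ring.
  apply: rpredB; last exact: dvd_sum_cofac.
  by rewrite rpredN (total_cofac i) dvdz_mull// dvdz_mulr.
apply/dvdzP; exists (- n%:Z * q - ((- (n%:Z * p' p i)) %/ (p i)%:Z)%Z * cofac i).
by rewrite /res /modz [RHS]mulrBl -(mulrA _ q) -qE; ring.
Qed.

(** Since e_0 < 0, the terms linear in n add up to - n (e_0 P + sum_i p'_i P / p_i), which is n by
    [seifert_eq]. *)
Lemma total_Delta n :
  total%:Z * Delta p n = total%:Z + n%:Z - \sum_i res i n * cofac i.
Proof.
have ceilE i : total%:Z * Num.ceil (n%:R * (p' p i)%:~R / (p i)%:R : rat) =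
    n%:Z * (p' p i * cofac i) + res i n * cofac i.
  have := @ceil_divz (n%:Z * p' p i) _ (p_gt0z i).
  rewrite intrM -!pmulrn -/(res i n) (total_cofac i) => cE.
  by rewrite mulrAC [_ * Num.ceil _]mulrC cE; ring.
rewrite /Delta mulrBr mulr_sumr; under eq_bigr do rewrite ceilE.
rewrite big_split/= -mulr_sumr (ltr0_norm e0_lt0).
have := seifert_eq; move: (\sum_i p' p i * _) => S /(canRL (addKr _)) ->; ring.
Qed.

(** The residues have period P, so in [total_Delta] only the term n changes. *)
Lemma DeltaD m t : Delta p (m + t * total) = Delta p m + t%:Z.
Proof.
have t0 : total%:Z != 0 by have := total_gt0; lia.
apply: (mulfI t0); rewrite [RHS]mulrDr !total_Delta PoszD PoszM.
suff -> : \sum_i res i (m + t * total) * cofac i = \sum_i res i m * cofac i by ring.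
apply: eq_bigr => i _; congr (_ * _); rewrite /res PoszD PoszM (total_cofac i).
rewrite (_ : - _ = (- t%:Z * cofac i * p' p i) * (p i)%:Z - m%:Z * p' p i).
  by rewrite modzMDl.
by ring.
Qed.

(** By [total_Delta], 1 - Delta(m) and m are the quotient and the remainder by P of sum_i r_i(m) P /
    p_i, which lies in [0, l P). *)
Lemma Delta_bounds m : (0 < l)%N -> (m < total)%N -> 0 <= 1 - Delta p m < l%:Z.
Proof.
move=> l0 mP; have tD := total_Delta m; have t0 := total_gt0.
have S0 : 0 <= \sum_i res i m * cofac i.
  apply: sumr_ge0 => i _; rewrite mulr_ge0 ?(ltW (cofac_gt0 i))//.
  by case/andP: (res_bound i m).
have S1 : \sum_i res i m * cofac i < l%:Z * total%:Z.
  have -> : l%:Z * total%:Z = \sum_(i < l) total%:Z.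
    by rewrite sumr_const card_ord -mulr_natl natz.
  apply: ltr_sum; first by apply/hasP; exists (Ordinal l0); rewrite ?mem_index_enum.
  move=> i _; rewrite (total_cofac i) ltr_pM2r ?cofac_gt0//.
  by case/andP: (res_bound i m).
by apply/andP; split; nia.
Qed.

(** Both m and n are the remainder by P of the same sum_i r_i P / p_i. *)
Lemma res_inj m n : (m < total)%N -> (n < total)%N ->
  (forall i, res i m = res i n) -> m = n.
Proof.
move=> mP nP mn; have := total_Delta m; have := total_Delta n.
under eq_bigr do rewrite -mn.
move: (\sum_i _) (Delta p n) (Delta p m) => S a b nE mE.
by have [ab|ab|ab] := ltgtP a b; nia.
Qed.

(** The witness is s modulo P, where s = sum_j r_j P / p_j. Modulo [p i] both [res i m * cofac i]
    and [r i * cofac i] equal s, and [cofac i] cancels. *)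
Lemma res_surj (r : 'I_l -> int) : (forall i, 0 <= r i < (p i)%:Z) ->
  exists2 m, (m < total)%N & forall i, res i m = r i.
Proof.
move=> rp; have t0 := total_gt0.
have tn0 : total%:Z != 0 by lia.
pose s := \sum_j r j * cofac j.
have m0 := modz_ge0 s tn0; have mP := @ltz_pmod s total%:Z.
exists `|(s %% total%:Z)%Z|%N => [|i]; first by lia.
have : ((p i)%:Z %| (res i `|(s %% total%:Z)%Z| - r i) * cofac i)%Z.
  rewrite (_ : _ * _ = (res i `|(s %% total%:Z)%Z| * cofac i - (s %% total%:Z)%Z) +
     (s - r i * cofac i) - (s %/ total%:Z)%Z * total%:Z); last first.
    by rewrite /modz; ring.
  apply: rpredB; last by rewrite (total_cofac i) dvdz_mull// dvdz_mulr.
  apply: rpredD; last exact: dvd_sum_cofac.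
  by have := dvd_res i `|(s %% total%:Z)%Z|; rewrite gez0_abs.
rewrite Gauss_dvdzl ?coprime_cofac// -eqz_mod_dvd => /eqP.
by rewrite modz_small ?res_bound// [RHS]modz_small.
Qed.

End Residues.

(** * Rearranging finite sums and truncating series *)

Lemma sum_subn_bin2 (k l : nat) : (k <= l)%N -> (\sum_(t < l) (k - t.+1) = 'C(k, 2))%N.
Proof.
(* Truncated subtraction kills the terms with t >= k; the others, reversed, are 0, 1, ..., k - 1. *)
move=> kl; rewrite -(subnKC kl) big_split_ord/= [X in (_ + X)%N]big1 ?addn0; last first.
  by move=> i _; lia.
rewrite (reindex_inj rev_ord_inj)/= -bin2_sum big_mkord.
by apply: eq_bigr => i _; have := ltn_ord i; lia.
Qed.

Lemma big_ord_mul (a b : nat) (F : nat -> nat) :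
  (\sum_(n < a * b) F n = \sum_(m < b) \sum_(t < a) F (m + t * b))%N.
Proof.
rewrite exchange_big/=; elim: a => [|a IH]; first by rewrite mul0n !big_ord0.
rewrite mulSn addnC big_split_ord/= IH big_ord_recr/=; congr addn.
by apply: eq_bigr => i _; rewrite addnC.
Qed.

Lemma eseries_finite_support (R : realType) (u : nat -> \bar R) (N : nat) :
  (forall n, (N <= n)%N -> u n = 0%E) ->
  (\sum_(0 <= n <oo) u n = \sum_(0 <= n < N) u n)%E.
Proof.
move=> u0; apply: lim_near_cst => //; near=> n.
rewrite (@big_cat_nat _ _ _ N)//=; last by near: n; exact: nbhs_infty_ge.
rewrite [X in (_ + X)%E]big1_seq ?adde0// => i.
by rewrite mem_index_iota => /andP[_ /andP[Ni _]]; exact: u0.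
Unshelve. all: by end_near. Qed.

(** * [kappa] as a sum over one period, grouped by level *)

Section Counting.
Variables (l : nat) (p : 'I_l -> nat).
Hypothesis l_gt0 : (0 < l)%N.
Hypothesis p_gt1 : forall i, (1 < p i)%N.
Hypothesis p_coprime : forall i j, i != j -> coprime (p i) (p j).

(** This is the K of the overview; for m < P the absolute value only serves to land in [nat]. *)
Definition level (m : nat) : nat := `|1 - Delta p m|%N.

Lemma level_Delta m : (m < total p)%N -> (level m)%:Z = 1 - Delta p m.
Proof. by move=> /(Delta_bounds p_gt1 p_coprime l_gt0)/andP[? _]; rewrite gez0_abs. Qed.

Lemma level_lt m : (m < total p)%N -> (level m < l)%N.
Proof.
by move=> mP; have /andP[_] := Delta_bounds p_gt1 p_coprime l_gt0 mP; rewrite -level_Delta.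
Qed.

Lemma kappa_level (R : realType) :
  kappa R p = (\sum_(m < total p) 'C(level m, 2))%N%:R%:E.
Proof.
have min_nat n : Num.min 0 (Delta p n) = - (`|(Num.min 0 (Delta p n))%R|%N)%:Z by lia.
(* Here Delta(m + t P) = 1 - K + t, and truncated subtraction encodes the minimum with 0. *)
have minE m (t : 'I_l) : (m < total p)%N ->
    `|(Num.min 0 (Delta p (m + t * total p)%N))%R|%N = (level m - t.+1)%N.
  move=> mP; rewrite DeltaD//; have := level_Delta mP; lia.
(* After l periods [Delta] is positive, because K < l on the first one. *)
rewrite /kappa (@eseries_finite_support _ _ (l * total p)%N); last first.
  move=> n nP; have t0 := total_gt0 p_gt1.
  rewrite (divn_eq n (total p)) addnC DeltaD//.
  have := Delta_bounds p_gt1 p_coprime l_gt0 (ltn_pmod n t0).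
  have : (l <= n %/ total p)%N by rewrite leq_divRL.
  by move=> ? ?; rewrite min_l//; lia.
under eq_bigr do rewrite min_nat.
rewrite sumEFin abse_EFin big_mkord; congr EFin.
rewrite -rmorph_sum/= sumrN rmorphN normrN.
rewrite (_ : \sum_(i < _) _ = (\sum_(n < l * total p) `|(Num.min 0 (Delta p n))%R|)%N%:Z).
  rewrite /= -pmulrn normr_nat; congr _%:R.
  rewrite (big_ord_mul _ _ (fun n => `|(Num.min 0 (Delta p n))%R|%N)).
  apply: eq_bigr => m _; rewrite -(@sum_subn_bin2 _ l) ?(ltnW (level_lt _))//.
  by apply: eq_bigr => t _; rewrite minE.
by rewrite -natz natr_sum; apply: eq_bigr => i _; rewrite natz.
Qed.

Lemma sum_bin2_level :
  (\sum_(m < total p) 'C(level m, 2) =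
   \sum_(1 <= j < l.-1) #|[set m : 'I_(total p) | level m == l - j]| * 'C(l - j, 2))%N.
Proof.
under eq_bigr => j _ do rewrite -sum1dep_card big_distrl/= big_mkcond/=.
rewrite exchange_big/=; apply: eq_bigr => m _.
have lm := level_lt (ltn_ord m).
have [lm2|lm2] := ltnP (level m) 2.
  (* Levels 0 and 1 would need j = l or j = l - 1, outside the range of summation, and their
     binomial is 0. *)
  rewrite bin_small// big_nat big1// => j /andP[j1 jl].
  by case: eqP => //; lia.
rewrite (bigD1_seq (l - level m)%N) ?iota_uniq//=; last first.
  by rewrite mem_index_iota; lia.
rewrite (_ : l - (l - level m) = level m)%N ?eqxx ?mul1n; last by lia.
rewrite big_nat_cond big1 ?addn0// => j /andP[/andP[j1 jl] jn].
by case: eqP => // e; move: jn; rewrite e; lia.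
Qed.
End Counting.

(** * Lattice points of the tetrahedra *)

Section Tetrahedra.
Variables (R : realType) (l : nat) (p : 'I_l -> nat).
Hypothesis l_gt0 : (0 < l)%N.
Hypothesis p_gt1 : forall i, (1 < p i)%N.
Hypothesis p_coprime : forall i j, i != j -> coprime (p i) (p j).

Let t0 : 0 < (total p)%:R :> R.
Proof. by rewrite ltr0n total_gt0. Qed.

Definition reflected (m : nat) : 'rV[R]_l := \row_i ((p i)%:Z - 1 - res p i m)%:~R.

Lemma prod_total : \prod_i (p i)%:R = (total p)%:R :> R.
Proof. by rewrite /total natr_prod. Qed.

Lemma div_cofac (c : int) i : c%:~R / (p i)%:R = (c * cofac p i)%:~R / (total p)%:R :> R.
Proof.
have p0 : (p i)%:R != 0 :> R by rewrite pnatr_eq0; have := p_gt1 i; lia.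
have c0 : (cofac p i)%:~R != 0 :> R by rewrite intr_eq0 (lt0r_neq0 (cofac_gt0 p_gt1 i)).
have -> : (total p)%:R = (p i)%:R * (cofac p i)%:~R :> R.
  by rewrite !pmulrn (total_cofac p i) intrM.
rewrite intrM; field; exact/andP.
Qed.

(** With N_0(k) an integer, the inequality defining T_k can be decided in [int]. *)
Lemma N0E k : N0 R p k = (k * (total p)%:Z - \sum_i cofac p i)%:~R.
Proof.
rewrite /N0 prod_total mulrBr rmorphB/= intrM -pmulrn mulrC; congr (_ - _).
rewrite mulr_sumr rmorph_sum/=; apply: eq_bigr => i _.
by rewrite -[_^-1]mul1r (div_cofac 1 i) mul1r mulrC divfK// lt0r_neq0.
Qed.

(* By this, the convention for N_0(k) = 0 in [tetrahedron] is immaterial. *)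
Lemma N0_neq0 k : N0 R p k != 0.
Proof. by rewrite N0E intr_eq0 subr_eq0 eq_sym sum_cofac_neq. Qed.

Lemma sum_reflected m :
  \sum_i reflected m ord0 i / (p i)%:R =
  (l%:Z * (total p)%:Z - \sum_i cofac p i - \sum_i res p i m * cofac p i)%:~R
    / (total p)%:R.
Proof.
under eq_bigr do rewrite mxE div_cofac.
rewrite -mulr_suml -rmorph_sum/=; congr (_%:~R / _).
have -> : l%:Z * (total p)%:Z = \sum_(i < l) (total p)%:Z.
  by rewrite sumr_const card_ord -mulr_natl natz.
rewrite -!sumrB; apply: eq_bigr => i _; rewrite (total_cofac p i); ring.
Qed.

Lemma reflected_ge0 m i : 0 <= reflected m ord0 i <= (p i)%:R - 1.
Proof.
have := res_bound p_gt1 i m; rewrite mxE => rb.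
rewrite ler0z (pmulrn _ (p i)) -(intrB _ _ 1) ler_int; lia.
Qed.

(** After multiplication by P and cancellation of the cofactor sum, membership reads (l - k) P <= K
    P + m; as 0 <= m < P, this means l - k <= K. *)
Lemma tetrahedron_reflected (k : int) m : (m < total p)%N ->
  tetrahedron R p k (reflected m) <-> l%:Z - k <= (level p m)%:Z.
Proof.
move=> mP; have lE := level_Delta l_gt0 p_gt1 p_coprime mP.
have tE := total_Delta p_gt1 p_coprime m.
have sum_le : \sum_i reflected m ord0 i / (p i)%:R <= N0 R p k / \prod_i (p i)%:R <->
    l%:Z - k <= (level p m)%:Z.
  rewrite sum_reflected N0E prod_total ler_pM2r ?invr_gt0// ler_int.
  move: (\sum_i cofac p i) (\sum_i _) (Delta p m) tE lE => C S D tE lE; split; nia.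
rewrite /tetrahedron; case: ltP => [N0k|N0k] /=.
  by split=> [[_ /sum_le]|/sum_le]//; split=> // i; case/andP: (reflected_ge0 m i).
(* Here T_k is empty and N_0(k) < 0, so the level bound must fail too: it would bound a sum of
   nonnegative terms by a negative number. *)
split=> // /sum_le; rewrite prod_total leNgt => /negP[].
apply: (@lt_le_trans _ _ 0).
  by rewrite pmulr_llt0 ?invr_gt0// lt_neqAle N0_neq0.
by apply: sumr_ge0 => i _; rewrite divr_ge0//; case/andP: (reflected_ge0 m i).
Qed.

Lemma reflected_inj m n : (m < total p)%N -> (n < total p)%N ->
  reflected m = reflected n -> m = n.
Proof.
move=> mP nP /rowP mn; apply: (res_inj p_gt1 p_coprime mP nP) => i.
by have := mn i; rewrite !mxE => /intr_inj; lia.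
Qed.

Lemma reflected_surj x : box R p x -> lattice R l x ->
  exists2 m, (m < total p)%N & x = reflected m.
Proof.
move=> xb xl; pose y i := Num.floor (x ord0 i).
have xy i : x ord0 i = (y i)%:~R by rewrite floorK.
have [i|m mP mE] := @res_surj _ _ p_gt1 p_coprime (fun i => (p i)%:Z - 1 - y i).
  have := xb i; rewrite xy ler0z (pmulrn _ (p i)) -(intrB _ _ 1) ler_int; lia.
by exists m => //; apply/rowP => i; rewrite mxE xy mE; congr _%:~R; ring.
Qed.

(** Lying in T_j but not in T_(j-1) means l - j <= K < l - j + 1. *)
Lemma A_level j : (j <= l)%N ->
  A R p j%:Z = #|[set m : 'I_(total p) | level p m == (l - j)%N]|.
Proof.
move=> jl; rewrite /A; set C := [set m | _].
have -> : ((tetrahedron R p j%:Z `\` tetrahedron R p (j%:Z - 1)) `&` box R p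
    `&` lattice R l)%classic =
    ((fun m : 'I_(total p) => reflected m) @`
      [set` C])%classic.
  apply/seteqP; split=> [x [[[xT xT'] xb] xl]|_ [m /= + <-]].
    have [m mP xE] := reflected_surj xb xl; exists (Ordinal mP) => //=.
    rewrite inE/=; move: xT xT'; rewrite xE !tetrahedron_reflected//.
    by move=> /= ? /negP; lia.
  rewrite inE => /eqP mE; split; last by move=> i; rewrite mxE intr_int.
  split; last exact: reflected_ge0.
  by split; rewrite tetrahedron_reflected ?ltn_ord// mE; [|apply/negP]; lia.
have Cfin : finite_set [set` C]%classic by exact: finite_finpred.
rewrite fset_set_image// card_imfset/=; last first.
  by move=> m n mn; apply: val_inj; exact: reflected_inj mn.
have -> : fset_set [set` C]%classic = [fset x in C]%fset.
  by apply/fsetP => x; rewrite in_fset_set// mem_setE !inE.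
exact: (card_finset (mem C)).
Qed.

End Tetrahedra.

Unset Implicit Arguments.
Set Strict Implicit.

Theorem theorem4p5 (R : realType) (l : nat) (p : 'I_l -> nat)
    (l_ge3 : (3 <= l)%N)
    (p_gt1 : forall i, (1 < p i)%N)
    (p_incr : forall i j : 'I_l, (i < j)%N -> (p i < p j)%N)
    (p_coprime : forall i j : 'I_l, i != j -> coprime (p i) (p j)) :
  kappa R p =
  (\sum_(1 <= j < l.-1)
      ((l - j - 1) * (l - j))%N%:R / 2 * (A R p j%:Z)%:R)%:E.
Proof.
have l_gt0 : (0 < l)%N by exact: leq_trans l_ge3.
rewrite kappa_level// sum_bin2_level// natr_sum; congr EFin.
apply: eq_big_nat => j /andP[j1 jl].
rewrite (A_level R l_gt0 p_gt1 p_coprime); last by lia.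
rewrite natrM mulrC; congr (_ * _).
(* With k = l - j, [mul_bin_diag] gives k (k - 1) = 2 'C(k, 2). *)
by rewrite mulnC subn1 -(bin1 (l - j).-1) mul_bin_diag natrM mulrAC divff ?mul1r ?pnatr_eq0.
Qed.
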